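(* Assume $\xi_a\neq\xi_b$ and $\xi_a\neq\xi_b\pm\eta$ for all $a\ne b$. Let $M=N/2$ if $N$ is even and $M=(N-1)/2$ if $N$ is odd. Then $\tau(\lambda)$ is an eigenvalue of the antiperiodic transfer matrix $\mathcal T(\lambda)$ if and only if it can be written as $$\tau(\lambda)=\pm\tfrac12\big[p(\lambda-\eta)q(\lambda+\eta)-q(\lambda-\eta)p(\lambda+\eta)\big]$$ for some polynomial $q$ of degree $R\le M$ and some polynomial $p$ of degree $N-R$ such that $$\tfrac12\big[p(\lambda)q(\lambda-\eta)+q(\lambda)p(\lambda-\eta)\big]=d(\lambda).$$
   Context: Fix an integer $N\ge1$, a nonzero $\eta\in\mathbb C$ and complex inhomogeneity parameters $\xi_1,\dots,\xi_N$. Let $\mathbb V=\bigotimes_{n=1}^N V_n$ with $V_n\cong\mathbb C^2$. Let $R(\lambda)$ be the $4\times4$ matrix with rows $(\lambda+\eta,0,0,0)$, $(0,\lambda,\eta,0)$, $(0,\eta,\lambda,0)$, $(0,0,0,\lambda+\eta)$. The monodromy matrix is $T_0(\lambda)=R_{0N}(\lambda-\xi_N)\cdots R_{01}(\lambda-\xi_1)$ on $V_0\otimes\mathbb V$ ($V_0\cong\mathbb C^2$ auxiliary, $R_{0n}$ acting as $R$ on $V_0\otimes V_n$), written in $V_0$ as the $2\times2$ matrix with entries $A(\lambda),B(\lambda)$ (first row), $C(\lambda),D(\lambda)$ (second row). The antiperiodic transfer matrix is $\mathcal T(\lambda)=B(\lambda)+C(\lambda)=\mathrm{tr}_0(\sigma_0^xT_0(\lambda))$.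 Set $d(\lambda)=\prod_{n=1}^N(\lambda-\xi_n)$. A function $\tau(\lambda)$ is an eigenvalue of $\mathcal T$ if there is a nonzero $v\in\mathbb V$ with $\mathcal T(\lambda)v=\tau(\lambda)v$ for all $\lambda$. *)

(* Defs.v *)
From HB Require Import structures.
From mathcomp Require Import all_boot all_order all_algebra.
From mathcomp Require Import reals complex.
Set Implicit Arguments. Unset Strict Implicit. Unset Printing Implicit Defensive.
Import Order.TTheory GRing.Theory Num.Theory.
Local Open Scope ring_scope.
Local Open Scope complex_scope.

(* Basis of V = (C^2)^{(x)N}: spin configurations s : 'I_N -> bool
   (false = first basis vector of C^2, true = second). *)
Definition spins (N : nat) := {ffun 'I_N -> bool}.
(* Basis of V_0 (x) V: (auxiliary spin, configuration). *)
Definition fullst (N : nat) := (bool * spins N)%type.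

(* Operators on a space with finite basis S, given by their matrix kernels. *)
Definition opmul (K : nzRingType) (S : finType) (A B : S -> S -> K) : S -> S -> K :=
  fun x z => \sum_(y : S) A x y * B y z.
Definition opid (K : nzRingType) (S : finType) : S -> S -> K :=
  fun x y => (x == y)%:R.

(* R_{0n}(mu) = mu * Id + eta * P_{0n}, i.e. the 4x4 matrix
   rows (mu+eta,0,0,0),(0,mu,eta,0),(0,eta,mu,0),(0,0,0,mu+eta)
   acting on V_0 (x) V_n, identity on the other sites. *)
Definition Rop (K : nzRingType) (N : nat) (eta : K) (n : 'I_N) (mu : K)
  : fullst N -> fullst N -> K :=
  fun x y =>
    let: (a, s) := x in let: (a', s') := y in
    (([forall m, (m != n) ==> (s m == s' m)])%:R) *
    (mu * ((a == a') && (s n == s' n))%:R + eta * ((a == s' n) && (s n == a'))%:R).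

Definition monodromy (K : nzRingType) (N : nat) (eta : K) (xi : 'I_N -> K) (lam : K)
  : fullst N -> fullst N -> K :=
  \big[@opmul K (fullst N)/@opid K (fullst N)]_(n <- rev (enum 'I_N)) Rop eta n (lam - xi n).

(* Antiperiodic transfer matrix  B(lambda) + C(lambda) = tr_0 (sigma^x_0 T_0(lambda)). *)
Definition antiper_transfer (K : nzRingType) (N : nat) (eta : K) (xi : 'I_N -> K) (lam : K)
  : spins N -> spins N -> K :=
  fun s s' => monodromy eta xi lam (false, s) (true, s')
            + monodromy eta xi lam (true, s) (false, s').

Definition is_eigenvalue (K : nzRingType) (N : nat) (eta : K) (xi : 'I_N -> K)
  (tau : K -> K) : Prop :=
  exists v : spins N -> K, (exists s, v s != 0) /\
    forall lam s, \sum_(s' : spins N) antiper_transfer eta xi lam s s' * v s' = tau lam * v s.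

Definition dfun (K : nzRingType) (N : nat) (xi : 'I_N -> K) (lam : K) : K :=
  \prod_(n < N) (lam - xi n).

(* Main.v *)
Require Import Defs.
From HB Require Import structures.
From mathcomp Require Import all_boot all_order all_algebra.
From mathcomp Require Import reals complex.
From mathcomp Require Import ring zify.
Set Implicit Arguments. Unset Strict Implicit. Unset Printing Implicit Defensive.
Import Order.TTheory GRing.Theory Num.Theory.
Local Open Scope ring_scope.

(* Write T = B + C for the antiperiodic transfer matrix, a(x) = d(x + eta).
   The eigenvalues are exactly the polynomials tau of degree < N such that
   tau(xi_k) tau(xi_k - eta) = - a(xi_k) d(xi_k - eta) for all k.

   Necessity is fusion: the operators at xi_k and xi_k - eta multiply to minus the
   quantum determinant.  Sufficiency is separation of variables: if <0| is the
   all-up covector, then <h| = <0| prod_k T(xi_k)^(h_k) is an eigencovector of D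
   with eigenvalue prod_k (x - xi_k + h_k eta), because B(xi_k) kills <h| when
   h_k = 0, so that T(xi_k) acts there as C(xi_k).  By fusion <h| is nonzero, hence
   these 2^N covectors form a basis, on which T(xi_k - h_k eta) just flips h_k.
   The vector v with <h|v> = prod_k tau(xi_k)^(h_k) is then an eigenvector, by
   Lagrange interpolation of T and tau at the N points xi_k - h_k eta.

   Given such a tau, the equations a(xi_k) Q(xi_k - eta) = - tau(xi_k) Q(xi_k) have
   a nonzero polynomial solution Q of degree <= N, and counting the 2N zeros
   xi_k, xi_k - eta yields tau Q = d Q(x + eta) - a Q(x - eta).  With P the solution
   attached to - tau, W = P(x) Q(x - eta) + Q(x) P(x - eta) satisfies
   d(x) W(x + eta) = d(x + eta) W(x), so W is a nonzero multiple of d, and therefore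
   deg P + deg Q = N; q is the one of smaller degree. *)

(** * Exchange relations, fusion and commutation for 2x2 matrices of operators *)

Section MatrixFamilies.
Variables (K : numFieldType) (n : nat) (eta : K).
Implicit Types (X Y : bool -> bool -> K -> 'M[K]_n) (u x y : K).

Definition fam_mul X Y a b x : 'M[K]_n := \sum_(c : bool) X a c x *m Y c b x.

Definition fam_comm X Y := forall a b c d x y,
  X a b x *m Y c d y = Y c d y *m X a b x.

(** Components of R(x - y) T_1(x) T_2(y) = T_2(y) T_1(x) R(x - y), where R(mu) = mu + eta P and
    [X a b] is the entry of T in auxiliary row a and column b. *)
Definition RTT X := forall a b c d x y,
  (x - y) *: (X a b x *m X c d y - X c d y *m X a b x)
  = eta *: (X c b y *m X a d x - X c b x *m X a d y).

Definition eps2 (a b : bool) : K := b%:R - a%:R.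

(** Antisymmetrizing T_1(u) T_2(u - eta) in its columns makes it antisymmetric in its rows too,
    leaving one scalar: the quantum determinant. [eps2] is the antisymmetric symbol. *)
Definition has_qdet X u (delta : K) := forall a b c d,
  X c d u *m X a b (u - eta) - X c b u *m X a d (u - eta)
  = (eps2 c a * eps2 d b * delta)%:M.

(* T_1(u) T_2(u - eta) = P^- T_1(u) T_2(u - eta), with P^- the antisymmetrizer
   of the two auxiliary spaces; it holds only at the inhomogeneities. *)
Definition fused X u := forall a b c d,
  X c d u *m X a b (u - eta) = - (X a d u *m X c b (u - eta)).

Definition fam_twist X x := X false true x + X true false x.

Lemma fam_mulM X Y : fam_comm X Y -> forall a b c d x y,
  fam_mul X Y a b x *m fam_mul X Y c d y
  = \sum_(i : bool) \sum_(j : bool)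
      (X a i x *m X c j y) *m (Y i b x *m Y j d y).
Proof.
move=> cXY a b c d x y; rewrite /fam_mul mulmx_suml; apply: eq_bigr => i _.
rewrite mulmx_sumr; apply: eq_bigr => j _.
by rewrite -!mulmxA; congr (_ *m _); rewrite !mulmxA cXY.
Qed.

Lemma RTT_fam_mul X Y : fam_comm X Y -> RTT X -> RTT Y -> RTT (fam_mul X Y).
Proof.
move=> cXY hX hY a b c d x y; rewrite !(fam_mulM cXY).
rewrite [X in _ *: (_ - X) = _]exchange_big /= -sumrB scaler_sumr.
(* One factor is exchanged at a time: AB - A'B' = (A - A')B + A'(B - B'). The [t1] terms cancel
   after swapping i and j. *)
pose t1 i j := X c i y *m X a j x *m (Y i b x *m Y j d y).
pose t2 i j := X c i x *m X a j y *m (Y i b x *m Y j d y).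
pose t3 i j := X c j y *m X a i x *m (Y j b y *m Y i d x).
transitivity (eta *: (\sum_(i : bool) \sum_(j : bool)
   ((t1 i j - t2 i j) + (t3 i j - t1 j i)))).
  rewrite scaler_sumr; apply: eq_bigr => i _.
  rewrite -sumrB !scaler_sumr; apply: eq_bigr => j _.
  rewrite /t1 /t2 /t3 -mulmxBl -mulmxBr [RHS]scalerDr.
  rewrite [X in _ = X + _]scalemxAl [X in _ = _ + X]scalemxAr.
  rewrite -hX -hY -scalemxAl -scalemxAr -scalerDr; congr (_ *: _).
  by rewrite mulmxBl mulmxBr addrA subrK.
congr (_ *: _).
under [LHS]eq_bigr => i _ do rewrite big_split /= !sumrB.
rewrite big_split /= !sumrB [X in _ + (_ - X)]exchange_big /=.
rewrite [X in _ + (X - _)]exchange_big /= /t3 /t2.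
by rewrite addrC addrA subrK.
Qed.

(** Antisymmetrizing the outer columns makes [Y] antisymmetric in the summed indices, so [X] enters
    through its own antisymmetrized columns. *)
Lemma has_qdet_fam_mul X Y u dX dY : fam_comm X Y ->
  has_qdet X u dX -> has_qdet Y u dY -> has_qdet (fam_mul X Y) u (dX * dY).
Proof.
move=> cXY hX hY a b c d; rewrite !(fam_mulM cXY) -sumrB.
under eq_bigr => i _ do
  (rewrite -sumrB; under eq_bigr => j _ do rewrite -mulmxBr hY).
rewrite !big_bool /= /eps2 !subrr !mul0r !(raddf0 (@scalar_mx K n)) !mulmx0 add0r addr0.
rewrite sub0r subr0 mulN1r mulNr !mul1r raddfN /= mulmxN -mulNmx -mulmxDl.
rewrite addrC [X in X *m _](_ : _ = (eps2 c a * dX)%:M).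
  by rewrite -scalar_mxM; congr (_%:M); rewrite /eps2; ring.
by rewrite hX; congr (_%:M); rewrite /eps2 subr0 mulr1.
Qed.

Lemma fused_mull X Y u : fam_comm X Y -> fused X u -> fused (fam_mul X Y) u.
Proof.
move=> cXY hX a b c d; rewrite !(fam_mulM cXY) -sumrN; apply: eq_bigr => i _.
by rewrite -sumrN; apply: eq_bigr => j _; rewrite hX mulNmx.
Qed.

Lemma eq_oppmx0 (M : 'M[K]_n) : M = - M -> M = 0.
Proof.
move=> h; apply/matrixP => i j; rewrite mxE; apply/eqP.
by rewrite -eqNr {2}h mxE.
Qed.

(** The fused [Y] retains only the part of [X] antisymmetric in its columns, which by [has_qdet] is
    antisymmetric in its rows as well. *)
Lemma fused_mulr X Y u dX : fam_comm X Y -> has_qdet X u dX ->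
  fused Y u -> fused (fam_mul X Y) u.
Proof.
move=> cXY hX hY a b c d; rewrite !(fam_mulM cXY) !big_bool /=.
have Y0 e : Y e d u *m Y e b (u - eta) = 0 by apply: eq_oppmx0; exact: hY.
rewrite !Y0 !mulmx0 !add0r !addr0 (hY true b false d) !mulmxN.
rewrite -!mulmxBl -mulNmx; congr (_ *m _).
by rewrite !hX -raddfN /=; congr (_%:M); rewrite /eps2; ring.
Qed.

(** Fusion kills the terms BB and CC and turns CB into -AD; what is left is BC - AD. *)
Lemma twist_fusion X u delta : fused X u -> has_qdet X u delta ->
  fam_twist X u *m fam_twist X (u - eta) = (- delta)%:M.
Proof.
move=> hf hq; rewrite /fam_twist mulmxDl !mulmxDr.
have X0 e b d : X e d u *m X e b (u - eta) = 0 by apply: eq_oppmx0; exact: hf.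
rewrite !X0 add0r addr0 (hf false true true false).
have := hq true true false false; rewrite /eps2 !subr0 !mul1r => hd.
rewrite (raddfN (@scalar_mx K n)) /= -hd.
by rewrite opprB.
Qed.

Lemma mxDE (A B : 'M[K]_n) i j : (A + B) i j = A i j + B i j.
Proof. by rewrite mxE. Qed.
Lemma mxNE (A : 'M[K]_n) i j : (- A) i j = - A i j.
Proof. by rewrite mxE. Qed.
Lemma mxZE (k : K) (A : 'M[K]_n) i j : (k *: A) i j = k * A i j.
Proof. by rewrite mxE. Qed.

Lemma RTT_entry X : RTT X -> forall a b c d x y i j,
  (x - y) * ((X a b x *m X c d y) i j - (X c d y *m X a b x) i j)
  = eta * ((X c b y *m X a d x) i j - (X c b x *m X a d y) i j).
Proof.
move=> hX a b c d x y i j; have /matrixP/(_ i j) := hX a b c d x y.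
by rewrite !(mxZE, mxDE, mxNE).
Qed.

Hypothesis eta0 : eta != 0.

(** For equal index pairs, swapping x and y fixes the left side of the exchange relation and negates
    the right side. This also covers x - y = -eta. *)
Lemma RTT_comm_same X : RTT X -> forall a b x y,
  X a b x *m X a b y = X a b y *m X a b x.
Proof.
move=> /RTT_entry hX a b x y; apply/matrixP => i j.
have h1 := hX a b a b x y i j; have h2 := hX a b a b y x i j.
move: ((X a b x *m X a b y) i j) ((X a b y *m X a b x) i j) h1 h2 => s t h1 h2.
apply/eqP; rewrite -subr_eq0 -(mulrI_eq0 _ (mulfI eta0)).
rewrite -eqNr; apply/eqP.
transitivity (eta * (t - s)); first by ring.
by rewrite -h1 -h2; ring.
Qed.

Lemma RTT_twist_comm X : RTT X -> forall x y,
  fam_twist X x *m fam_twist X y = fam_twist X y *m fam_twist X x.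
Proof.
move=> hX x y; have [-> //|xy] := eqVneq x y.
have xy0 : x - y != 0 by rewrite subr_eq0.
rewrite /fam_twist !mulmxDl !mulmxDr !(RTT_comm_same hX _ _ y x).
apply/matrixP => i j; rewrite !mxDE.
have h1 := RTT_entry hX false true true false x y i j.
have h2 := RTT_entry hX true false false true x y i j.
have h3 := RTT_entry hX false false true true x y i j.
have h4 := RTT_entry hX false false true true y x i j.
move: h1 h2 h3 h4.
move: ((X false true x *m X true false y) i j)
      ((X true false x *m X false true y) i j)
      ((X false true y *m X true false x) i j)
      ((X true false y *m X false true x) i j)
      ((X false true x *m X false true y) i j)
      ((X true false x *m X true false y) i j).
move: ((X false false x *m X true true y) i j)
      ((X true true x *m X false false y) i j)
      ((X false false y *m X true true x) i j)
      ((X true true y *m X false false x) i j).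
move=> ad da ad' da' bc cb bc' cb' bb cc h1 h2 h3 h4.
(* The exchange relation is applied twice, from BC and CB to AD and DA and back, hence the factor (x
   - y)^2. *)
apply/eqP; rewrite -subr_eq0 -(mulrI_eq0 _ (mulfI xy0)).
rewrite -(mulrI_eq0 _ (mulfI xy0)); apply/eqP.
transitivity ((x - y) * ((x - y) * (bc - cb') + (x - y) * (cb - bc'))).
  by ring.
rewrite h1 h2.
transitivity (- eta * ((y - x) * (ad' - da) + (x - y) * (ad - da'))).
  by ring.
by rewrite h3 h4; ring.
Qed.

End MatrixFamilies.

(** * Functions given by polynomials of bounded size *)

Section PolynomialFunctions.
Variable K : numFieldType.
Implicit Types (f g : K -> K) (k : nat).

Definition polyfun k f := exists2 p : {poly K}, (size p <= k)%N & forall x, f x = p.[x].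

Lemma eq_polyfun k f g : f =1 g -> polyfun k f -> polyfun k g.
Proof. by move=> fg [p sp hp]; exists p => // x; rewrite -fg. Qed.

Lemma polyfun_le k l f : (k <= l)%N -> polyfun k f -> polyfun l f.
Proof. by move=> kl [p sp hp]; exists p => //; apply: leq_trans kl. Qed.

Lemma polyfun_cst (c : K) : polyfun 1 (fun=> c).
Proof. by exists c%:P => [|x]; rewrite ?size_polyC_leq1 ?hornerC. Qed.

Lemma polyfun0 k : polyfun k (fun=> 0).
Proof. by exists 0 => [|x]; rewrite ?size_poly0 ?horner0. Qed.

Lemma polyfunD k f g : polyfun k f -> polyfun k g -> polyfun k (fun x => f x + g x).
Proof.
move=> [p sp hp] [q sq hq]; exists (p + q) => [|x]; last by rewrite hornerD hp hq.
by rewrite (leq_trans (size_polyD _ _)) // geq_max sp sq.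
Qed.

Lemma polyfunM k l f g : polyfun k.+1 f -> polyfun l g ->
  polyfun (k + l) (fun x => f x * g x).
Proof.
move=> [p sp hp] [q sq hq]; exists (p * q) => [|x]; last by rewrite hornerM hp hq.
by rewrite (leq_trans (size_polyMleq _ _)) //; lia.
Qed.

Lemma polyfunZ k f (c : K) : polyfun k f -> polyfun k (fun x => c * f x).
Proof. by move=> pf; apply: (@polyfunM 0 k) => //; apply: polyfun_cst. Qed.

Lemma polyfunB k f g : polyfun k f -> polyfun k g -> polyfun k (fun x => f x - g x).
Proof.
move=> pf pg; apply: polyfunD => //.
by apply: eq_polyfun (polyfunZ (-1) pg) => x; rewrite mulN1r.
Qed.

Lemma polyfun_sum (I : Type) (r : seq I) k (F : I -> K -> K) :
  (forall i, polyfun k (F i)) -> polyfun k (fun x => \sum_(i <- r) F i x).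
Proof.
move=> pF; elim: r => [|i r IHr].
  by apply: eq_polyfun (polyfun0 k) => x; rewrite big_nil.
by apply: eq_polyfun (polyfunD (pF i) IHr) => x; rewrite big_cons.
Qed.

Lemma polyfun_sub (c : K) : polyfun 2 (fun x => x - c).
Proof. by exists ('X - c%:P) => [|x]; rewrite ?size_XsubC ?hornerXsubC. Qed.

Lemma polyfun_prod (I : Type) (r : seq I) (c : I -> K) :
  polyfun (size r).+1 (fun x => \prod_(i <- r) (x - c i)).
Proof.
exists (\prod_(i <- r) ('X - (c i)%:P)) => [|x]; first by rewrite size_prod_XsubC.
by rewrite horner_prod; apply: eq_bigr => i _; rewrite hornerXsubC.
Qed.

Lemma polyfun_roots0 f (rs : seq K) : uniq rs -> polyfun (size rs) f ->
  (forall x, x \in rs -> f x = 0) -> forall x, f x = 0.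
Proof.
move=> urs [p sp hp] h x; have [p0|pn0] := eqVneq p 0.
  by rewrite hp p0 horner0.
have /(max_poly_roots pn0)/(_ urs) : all (root p) rs.
  by apply/allP => y /h fy; rewrite /root -hp fy.
by rewrite ltnNge sp.
Qed.

(** The points c + 1, ..., c + k are distinct in characteristic 0 and avoid c. This recovers the
    point lost when an exchange relation is divided by x - c. *)
Lemma polyfun_eq_off k f (c : K) : polyfun k f ->
  (forall x, x != c -> f x = 0) -> forall x, f x = 0.
Proof.
move=> pf h; pose rs := [seq c + i.+1%:R | i <- iota 0 k].
apply: (@polyfun_roots0 f rs).
- by rewrite map_inj_uniq ?iota_uniq // => i j /addrI /eqP; rewrite eqr_nat => /eqP[].
- by rewrite size_map size_iota.
by move=> _ /mapP[i _ ->]; apply: h; rewrite -subr_eq0 addrAC subrr add0r pnatr_eq0.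
Qed.

End PolynomialFunctions.

(** * Separation of variables: eigencovectors of D and eigenvectors of T *)

Section SeparatedBasis.
Variables (K : numFieldType) (N : nat) (eta : K) (xi : 'I_N -> K).
Local Notation n := #|spins N|.
Variables (X : bool -> bool -> K -> 'M[K]_n) (w0 : 'rV[K]_n) (kappa : 'I_N -> K).
Local Notation T := (fam_twist X).

Hypothesis eta0 : eta != 0.
Hypothesis xi_generic : forall a b : 'I_N, a != b ->
  [/\ xi a != xi b, xi a != xi b + eta & xi a != xi b - eta].
Hypothesis XRTT : RTT eta X.
Hypothesis Tfusion : forall k, T (xi k) *m T (xi k - eta) = (kappa k)%:M.
Hypothesis kappa0 : forall k, kappa k != 0.
Hypothesis w00 : w0 != 0.
Hypothesis w0B : forall x, w0 *m X false true x = 0.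
Hypothesis w0D : forall x, w0 *m X true true x = dfun xi x *: w0.
Hypothesis polyfunX : forall a b i j, polyfun N.+1 (fun x => X a b x i j).
Hypothesis polyfunT : forall i j, polyfun N (fun x => T x i j).

Fixpoint sepcov (s : seq 'I_N) : 'rV[K]_n :=
  if s is k :: s' then sepcov s' *m T (xi k) else w0.

(** Eigenvalue of D on the covector built from the sites in [A]: applying T(xi k) moves the zero xi
    k to xi k - eta. *)
Definition sepval (A : pred 'I_N) x := \prod_(k < N) (x - (xi k - (A k)%:R * eta)).

Lemma xi_shift_neq (a b : 'I_N) : xi a != xi b - eta.
Proof.
have [->|/xi_generic[]//] := eqVneq a b.
by rewrite -subr_eq0 opprB addrC subrK.
Qed.

Lemma sepval_add (A : pred 'I_N) k x : ~~ A k ->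
  (x - xi k) * sepval (predU1 k A) x = (x - xi k + eta) * sepval A x.
Proof.
move=> nAk; rewrite /sepval (bigD1 k) //= [in RHS](bigD1 k) //= eqxx (negbTE nAk) /=.
under eq_bigr => i ik do rewrite (negbTE ik) /=.
by ring.
Qed.

Lemma sepval0 A k : ~~ A k -> sepval A (xi k) = 0.
Proof. by move=> nA; rewrite /sepval (bigD1 k) //= (negbTE nA) mul0r subr0 subrr mul0r. Qed.

(** Joint induction: vanishing under B makes T(xi k) act as C(xi k), and exchanging C with B and D
    propagates both properties. *)
Lemma sepcov_props s : uniq s ->
  (forall k, k \notin s -> sepcov s *m X false true (xi k) = 0) /\
  (forall x, sepcov s *m X true true x = sepval (fun i => i \in s) x *: sepcov s).
Proof.
elim: s => [|k s IHs] /=.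
  move=> _; split=> [k _|x]; rewrite ?w0B // w0D; congr (_ *: _).
  by apply: eq_bigr => i _; rewrite in_nil mul0r subr0.
case/andP=> ks us; have [hB hD] := IHs us.
set w := sepcov s in hB hD *.
have TC : w *m T (xi k) = w *m X true false (xi k).
  by rewrite mulmxDr hB // add0r.
rewrite TC; set w' := w *m _.
split=> [l|x].
  rewrite inE negb_or => /andP[lk ls].
  have xlk : xi l - xi k != 0 by rewrite subr_eq0; case: (xi_generic lk).
  (* Neither k nor l lies in s, so D(xi k) and D(xi l) annihilate [w] and the right side of the BC
     relation drops out. *)
  have := congr1 (mulmx w) (XRTT false true true false (xi l) (xi k)).
  rewrite -!scalemxAr !mulmxBr !mulmxA !hD !hB // !sepval0 // !scale0r !mul0mx.
  rewrite subrr scaler0 sub0r scalerN => /eqP.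
  by rewrite oppr_eq0 scaler_eq0 (negbTE xlk) => /eqP.
have hoff y : y != xi k -> w' *m X true true y = sepval (fun i => i \in k :: s) y *: w'.
  move=> yk; have yk0 : y - xi k != 0 by rewrite subr_eq0.
  apply: (scalerI yk0); rewrite scalerA.
  rewrite [sepval _ _](_ : _ = sepval (predU1 k (fun i => i \in s)) y); last first.
    by apply: eq_bigr => i _; rewrite !inE.
  rewrite sepval_add //.
  have := congr1 (mulmx w) (XRTT true true true false y (xi k)).
  rewrite -!scalemxAr !mulmxBr !mulmxA !hD sepval0 // scale0r mul0mx sub0r.
  rewrite -scalemxAl -/w' => h.
  rewrite [LHS](_ : _ = (y - xi k) *: (sepval (fun i => i \in s) y *: w') - (y - xi k) *:
     (sepval (fun i => i \in s) y *: w' - w' *m X true true y)); last first.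
    by rewrite -scalerBr subKr.
  by rewrite h scalerN opprK !scalerA -scalerDl -mulrDl.
(* The excluded point x = xi k follows because both sides are polynomial in x. *)
apply/rowP => j; apply/eqP; rewrite -subr_eq0; apply/eqP; move: x.
apply: (@polyfun_eq_off _ N.+1 _ (xi k)); last first.
  by move=> y /hoff ->; rewrite subrr.
apply: polyfunB.
  apply: (@eq_polyfun _ _ (fun x => \sum_i w' 0 i * X true true x i j)).
    by move=> x; rewrite mxE.
  by apply: polyfun_sum => i; apply: polyfunZ.
apply: (@eq_polyfun _ _ (fun x => w' 0 j * sepval (fun i => i \in k :: s) x)).
  by move=> x; rewrite !mxE mulrC.
apply: polyfunZ; have := polyfun_prod (index_enum 'I_N) (fun i => xi i - (i \in k :: s)%:R * eta).
by have -> : size (index_enum 'I_N) = N by rewrite /index_enum unlock -enumT size_enum_ord.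
Qed.

Lemma sepcov_neq0 s : sepcov s != 0.
Proof.
elim: s => [|k s] //=; apply: contraNneq => h.
have := congr1 (mulmx^~ (T (xi k - eta))) h.
rewrite mul0mx -mulmxA Tfusion mul_mx_scalar => /eqP.
by rewrite scaler_eq0 (negbTE (kappa0 k)).
Qed.

Lemma sepcov_rem k s : k \in s -> sepcov s = sepcov (rem k s) *m T (xi k).
Proof.
elim: s => [|h s IHs] //=; rewrite inE eq_sym.
case: eqP => [<- //|_] /= /IHs ->.
by rewrite -!mulmxA (RTT_twist_comm eta0 XRTT).
Qed.

Definition spinup (h : spins N) := [seq k <- enum 'I_N | h k].
Definition flip_down (h : spins N) k : spins N := [ffun i => (i != k) && h i].

Lemma spinup_uniq h : uniq (spinup h).
Proof. by rewrite filter_uniq ?enum_uniq. Qed.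

Lemma mem_spinup h k : (k \in spinup h) = h k.
Proof. by rewrite mem_filter mem_enum andbT. Qed.

Lemma rem_spinup h k : rem k (spinup h) = spinup (flip_down h k).
Proof.
rewrite rem_filter ?spinup_uniq // -filter_predI; apply: eq_filter => i /=.
by rewrite ffunE.
Qed.

Lemma sepcov_down (h : spins N) k : h k ->
  sepcov (spinup h) = sepcov (spinup (flip_down h k)) *m T (xi k).
Proof. by move=> hk; rewrite -rem_spinup -sepcov_rem ?mem_spinup. Qed.

Definition sepmx : 'M[K]_n := \matrix_i sepcov (spinup (enum_val i)).

(* [sepcov (spinup h)] is an eigencovector of D whose eigenvalue has the zeros
   [xi k - (h k) eta], so that the product over k of D (seppt h k) isolates the index [h]. *)
Definition seppt (h : spins N) k := if h k then xi k else xi k - eta.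

Lemma seppt_diff (h g : spins N) k : h k != g k -> sepval g (seppt h k) = 0.
Proof.
rewrite /seppt => hg; rewrite /sepval (bigD1 k) //=.
by case: (h k) (g k) hg => [] [] //= _; rewrite ?mul1r ?mul0r ?subr0 subrr mul0r.
Qed.

Lemma seppt_same (h : spins N) k : sepval h (seppt h k) != 0.
Proof.
rewrite /sepval /seppt; apply/prodf_neq0 => i _; rewrite subr_eq0.
have [->|ik] := eqVneq k i.
  case: (h i) => /=; rewrite ?mul1r ?mul0r ?subr0 ?xi_shift_neq //.
  by rewrite eq_sym xi_shift_neq.
have [h1 h2 h3] := xi_generic ik.
case: (h k) (h i) => [] [] /=; rewrite ?mul1r ?mul0r ?subr0 ?xi_shift_neq //.
  by rewrite (inj_eq (addIr _)).
by rewrite subr_eq.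
Qed.

Lemma sepmx_unit : sepmx \in unitmx.
Proof.
rewrite -row_free_unit -kermx_eq0; apply/eqP/row_matrixP => r.
rewrite row0; set c := row r _.
have cS : c *m sepmx = 0 by rewrite /c -row_mul mulmx_ker row0.
have {}cS : \sum_i c 0 i *: sepcov (spinup (enum_val i)) = 0.
  by rewrite -[RHS]cS mulmx_sum_row; apply: eq_bigr => i _; rewrite rowK.
apply/rowP => j; rewrite [RHS]mxE; set h := enum_val j.
(* Applying D at the points [seppt h k] one after another multiplies each coefficient by an
   eigenvalue; once all sites are used, only the index [h] survives. *)
have step l : \sum_i (c 0 i * \prod_(k <- l) sepval (enum_val i) (seppt h k))
     *: sepcov (spinup (enum_val i)) = 0.
  elim: l => [|k l IHl].
    by under eq_bigr do rewrite big_nil mulr1.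
  have := congr1 (mulmx^~ (X true true (seppt h k))) IHl.
  rewrite mul0mx mulmx_suml => hk; rewrite -[RHS]hk; apply: eq_bigr => i _.
  rewrite -scalemxAl (sepcov_props (spinup_uniq _)).2 scalerA big_cons.
  congr (_ *: _); rewrite -mulrA; congr (_ * _); rewrite mulrC; congr (_ * _).
  by apply: eq_bigr => m _; rewrite mem_spinup.
have := step (enum 'I_N); rewrite (bigD1 j) //= [X in _ + X]big1 ?addr0; last first.
  move=> i ij.
  have /existsP[k hk] : [exists k, h k != enum_val i k].
    apply: contraNT ij => /existsPn hh; apply/eqP/enum_val_inj.
    by apply/ffunP => k; have /negPn/eqP -> := hh k.
  by rewrite (big_rem k) ?mem_enum //= seppt_diff // mul0r mulr0 scale0r.
move/eqP; rewrite scaler_eq0 (negbTE (sepcov_neq0 _)) orbF mulf_eq0.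
case/orP => [/eqP //|]; rewrite prodf_seq_eq0 => /hasP[k _] /=.
by rewrite (negbTE (seppt_same _ _)).
Qed.

Lemma twist_eigenvector (tau : K -> K) : polyfun N tau ->
  (forall k, tau (xi k) * tau (xi k - eta) = kappa k) ->
  exists2 v : 'cV[K]_n, v != 0 & forall x, T x *m v = tau x *: v.
Proof.
move=> ptau htau.
pose f (h : spins N) := \prod_(k <- spinup h) tau (xi k).
pose F : 'cV[K]_n := \col_i f (enum_val i).
exists (invmx sepmx *m F).
  apply/eqP => /(congr1 (mulmx sepmx)); rewrite mulKVmx ?sepmx_unit // mulmx0.
  move/colP/(_ (enum_rank [ffun=> false])); rewrite !mxE enum_rankK => /eqP.
  by rewrite /f big_filter big1 ?oner_eq0 // => k; rewrite ffunE.
set v := _ *m F; have hv h : sepcov (spinup h) *m v = (f h)%:M.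
  have : sepmx *m v = F by rewrite mulKVmx ?sepmx_unit.
  move/(congr1 (row (enum_rank h))); rewrite row_mul rowK enum_rankK => ->.
  by apply/matrixP => i j; rewrite !ord1 !mxE enum_rankK.
have fdown (h : spins N) k : h k -> f h = f (flip_down h k) * tau (xi k).
  by move=> hk; rewrite /f (big_rem k) ?mem_spinup //= mulrC rem_spinup.
pose up (h : spins N) k : spins N := [ffun i => (i == k) || h i].
have upK (h : spins N) k : ~~ h k -> flip_down (up h k) k = h.
  move=> hk; apply/ffunP => i; rewrite !ffunE.
  by case: eqP => // ->; rewrite (negbTE hk).
have upk h k : up h k k by rewrite ffunE eqxx.
(* At [pt h k] the operator T flips h_k alone: xi k raises it by construction, xi k - eta lowers it
   by fusion. These N distinct points suffice for degree below N. *)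
pose pt (h : spins N) k := if h k then xi k - eta else xi k.
have hpt h k : sepcov (spinup h) *m (T (pt h k) *m v) = (tau (pt h k) * f h)%:M.
  rewrite mulmxA /pt; case: ifPn => hk.
    rewrite (sepcov_down hk) -(mulmxA (sepcov _)) Tfusion mul_mx_scalar.
    rewrite -scalemxAl hv scale_scalar_mx (fdown h k) // -htau.
    by congr (_%:M); ring.
  rewrite -{1}(upK _ _ hk) -sepcov_down // hv (fdown _ k) // upK //.
  by rewrite mulrC.
have ptU h : uniq [seq pt h k | k <- enum 'I_N].
  rewrite map_inj_uniq ?enum_uniq // => i j; rewrite /pt => eij.
  apply/eqP; apply: contraT => /xi_generic[] h1 h2 h3; move: eij.
  case: ifP => _; case: ifP => _ /eqP; rewrite ?(inj_eq (addIr _)) ?(negbTE h1) //.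
    by rewrite subr_eq (negbTE h2).
  by rewrite (negbTE h3).
move=> x; apply/eqP; rewrite -subr_eq0; apply/eqP.
rewrite -[LHS](mulKmx sepmx_unit) [X in _ *m X](_ : _ = 0) ?mulmx0 //.
apply/row_matrixP => i; rewrite row0 row_mul rowK; set h := enum_val i.
rewrite mulmxBr -scalemxAr hv scale_scalar_mx.
apply/rowP => j; rewrite !ord1; move: x.
pose g x := (sepcov (spinup h) *m (T x *m v)) 0 0 - tau x * f h.
have g0 : forall x, g x = 0.
  apply: (@polyfun_roots0 _ g [seq pt h k | k <- enum 'I_N]) => //.
    rewrite size_map size_enum_ord; apply: polyfunB.
      apply: (@eq_polyfun _ _ (fun x => \sum_l (\sum_m
         (sepcov (spinup h) 0 l * v m 0) * T x l m))).
        move=> x; rewrite [RHS]mxE; apply: eq_bigr => l _; rewrite mxE mulr_sumr.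
        by apply: eq_bigr => m _; ring.
      by do 2!apply: polyfun_sum => ?; apply: polyfunZ.
    by apply: eq_polyfun (polyfunZ (f h) ptau) => x; rewrite mulrC.
  by move=> _ /mapP[k _ ->]; rewrite /g hpt mxE eqxx mulr1n subrr.
by move=> x; rewrite [RHS]mxE -(g0 x) /g !mxE eqxx mulr1n.
Qed.

End SeparatedBasis.

(** * Lax operators of the chain and the monodromy matrix as their product *)

Section SpinChain.
Variables (K : numFieldType) (N : nat) (eta : K) (xi : 'I_N -> K).
Local Notation n := #|spins N|.
Implicit Types (k : 'I_N) (s : spins N) (l : seq 'I_N).

Definition kernel_mx (A : spins N -> spins N -> K) : 'M[K]_n :=
  \matrix_(i, j) A (enum_val i) (enum_val j).

Definition set_spin s k b : spins N := [ffun i => if i == k then b else s i].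

(** Elementary matrix E_{ab} at site k, tensored with the identity elsewhere. *)
Definition site_unit k a b : 'M[K]_n :=
  kernel_mx (fun s s' => ((s k == a) && (s' == set_spin s k b))%:R).

(** Auxiliary entry (a, b) of R_{0k}(x - xi k). The indices of [site_unit] are reversed because P is
    the sum of all E_{ab} tensor E_{ba}. *)
Definition lax k a b x : 'M[K]_n :=
  ((x - xi k) * (a == b)%:R)%:M + eta *: site_unit k b a.

Fixpoint lax_prod l : bool -> bool -> K -> 'M[K]_n :=
  if l is k :: l' then fam_mul (lax k) (lax_prod l')
  else fun a b _ => ((a == b)%:R)%:M.

Lemma mul_site_unit k a b (M : 'M[K]_n) i j : (site_unit k a b *m M) i j
  = (enum_val i k == a)%:R * M (enum_rank (set_spin (enum_val i) k b)) j.
Proof.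
rewrite mxE (bigD1 (enum_rank (set_spin (enum_val i) k b))) //=.
rewrite big1 ?addr0 => [|r]; first by rewrite mxE enum_rankK eqxx andbT.
rewrite mxE; case: (enum_val r =P _) => [<-|]; first by rewrite enum_valK eqxx.
by rewrite andbF mul0r.
Qed.

Lemma site_unitE k a b i j : site_unit k a b i j
  = ((enum_val i k == a) && (enum_val j == set_spin (enum_val i) k b))%:R.
Proof. by rewrite mxE. Qed.

Lemma site_unitM k a b c d :
  site_unit k a b *m site_unit k c d = (b == c)%:R *: site_unit k a d.
Proof.
apply/matrixP => i j; rewrite mul_site_unit mxE [in RHS]mxE site_unitE.
rewrite enum_rankK ffunE eqxx.
have -> : set_spin (set_spin (enum_val i) k b) k d = set_spin (enum_val i) k d.
  by apply/ffunP => m; rewrite !ffunE; case: eqP.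
by do 3!case: (_ == _); rewrite ?mul0r ?mulr0 ?mul1r.
Qed.

Lemma site_unitC k m a b c d : k != m ->
  site_unit k a b *m site_unit m c d = site_unit m c d *m site_unit k a b.
Proof.
move=> km; apply/matrixP => i j; rewrite !mul_site_unit !site_unitE !enum_rankK.
rewrite !ffunE [m == k]eq_sym (negbTE km).
have -> : set_spin (set_spin (enum_val i) k b) m d
          = set_spin (set_spin (enum_val i) m d) k b.
  apply/ffunP => r; rewrite !ffunE; case: (r =P m) => // ->.
  by rewrite eq_sym (negbTE km).
by do 3!case: (_ == _); rewrite ?mul0r ?mulr0 ?mul1r.
Qed.

Lemma site_unit_sum k : site_unit k false false + site_unit k true true = 1%:M.
Proof.
apply/matrixP => i j; rewrite !mxE -!natrD; congr (_%:R).
rewrite -(inj_eq (@enum_val_inj _ (spins N))).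
have e b : enum_val i k = b -> set_spin (enum_val i) k b = enum_val i.
  by move=> <-; apply/ffunP => m; rewrite ffunE; case: eqP => // ->.
by case E: (enum_val i k) => /=; rewrite e // eq_sym ?addn0.
Qed.

Lemma kernel_mx_opmul (A B : fullst N -> fullst N -> K) a b :
  kernel_mx (fun s s' => opmul A B (a, s) (b, s'))
  = \sum_(c : bool) kernel_mx (fun s s' => A (a, s) (c, s'))
                    *m kernel_mx (fun s s' => B (c, s) (b, s')).
Proof.
apply/matrixP => i j; rewrite !mxE /opmul summxE.
transitivity (\sum_(c : bool) \sum_(s : spins N)
    A (a, enum_val i) (c, s) * B (c, s) (b, enum_val j)).
  by rewrite pair_bigA; apply: eq_bigr => -[].
apply: eq_bigr => c _; rewrite mxE big_enum_val /=.
by apply: eq_bigr => m _; rewrite !mxE.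
Qed.

Lemma kernel_mx_Rop k a b x :
  kernel_mx (fun s s' => Rop eta k (x - xi k) (a, s) (b, s')) = lax k a b x.
Proof.
apply/matrixP => i j; rewrite !mxE -(inj_eq (@enum_val_inj _ (spins N))) /Rop.
move: (enum_val i) (enum_val j) => s s'.
have e1 : (s == s') = [forall m, (m != k) ==> (s m == s' m)] && (s k == s' k).
  apply/eqP/andP => [->|[/forallP h /eqP hk]].
    by split=> //; apply/forallP => m; rewrite eqxx implybT.
  apply/ffunP => m; have [-> //|mk] := eqVneq m k.
  by have := h m; rewrite mk => /eqP.
have e2 : (s' == set_spin s k a) = [forall m, (m != k) ==> (s m == s' m)] && (a == s' k).
  apply/eqP/andP => [->|[/forallP h /eqP hk]].
    split; last by rewrite ffunE eqxx.
    by apply/forallP => m; rewrite ffunE; case: eqP => /=.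
  apply/ffunP => m; rewrite ffunE; have [-> //|mk] := eqVneq m k.
  by have := h m; rewrite mk => /eqP ->.
rewrite e1 e2; case: [forall m, _] => /=; last first.
  by rewrite andbF mul0r mulr0n mulr0 addr0.
rewrite mul1r; congr (_ + _ * _); last by rewrite andbC.
by do 2!case: (_ == _); rewrite ?mulr1 ?mulr0 ?mul0rn ?mulr0n ?mulr1n.
Qed.

Lemma kernel_mx_monodromy a b x :
  kernel_mx (fun s s' => monodromy eta xi x (a, s) (b, s'))
  = lax_prod (rev (enum 'I_N)) a b x.
Proof.
rewrite /monodromy; elim: (rev _) a b => [|k l IHl] a b /=.
  apply/matrixP => i j; rewrite !mxE big_nil /opid xpair_eqE.
  rewrite (inj_eq (@enum_val_inj _ (spins N))).
  by do 2!case: (_ == _).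
rewrite big_cons kernel_mx_opmul /fam_mul; apply: eq_bigr => c _.
by rewrite kernel_mx_Rop IHl.
Qed.

Lemma lax_lax k a b c d x y : lax k a b x *m lax k c d y
  = ((x - xi k) * (a == b)%:R * ((y - xi k) * (c == d)%:R))%:M
    + ((x - xi k) * (a == b)%:R * eta) *: site_unit k d c
    + ((y - xi k) * (c == d)%:R * eta) *: site_unit k b a
    + (eta * eta * (a == d)%:R) *: site_unit k b c.
Proof.
rewrite /lax mulmxDl !mulmxDr -scalar_mxM mul_scalar_mx mul_mx_scalar.
by rewrite -scalemxAl -scalemxAr site_unitM !scalerA -!addrA.
Qed.

Lemma scalar_mxE (z : K) (i j : 'I_n) : (z%:M : 'M[K]_n) i j = z * (i == j)%:R.
Proof. by rewrite mxE mulr_natr. Qed.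

Lemma lax_RTT k : RTT eta (lax k).
Proof.
move=> a b c d x y; rewrite !lax_lax; apply/matrixP => i j.
rewrite !(mxZE, mxDE, mxNE, scalar_mxE).
by ring.
Qed.

Lemma lax_qdet k x : has_qdet eta (lax k) x ((x - xi k + eta) * (x - eta - xi k)).
Proof.
have us i j : ((i == j)%:R : K) = site_unit k false false i j + site_unit k true true i j.
  by rewrite -mxDE site_unit_sum mxE.
move=> a b c d; rewrite !lax_lax; apply/matrixP => i j.
rewrite !(mxZE, mxDE, mxNE, scalar_mxE) us /eps2.
by case: a b c d => [] [] [] [] /=; ring.
Qed.

(** At u = xi k the two factors are eta P_{1k} and eta (P_{2k} - 1), and P_{1k} (P_{2k} - 1) =
    (P_{12} - 1) P_{1k}. *)
Lemma lax_fused k : fused eta (lax k) (xi k).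
Proof.
move=> a b c d; rewrite !lax_lax; apply/matrixP => i j.
rewrite !(mxZE, mxDE, mxNE, scalar_mxE).
by case: a b c d => [] [] [] [] /=; ring.
Qed.

Lemma site_unit_lax_prod k l a b c d x : k \notin l ->
  site_unit k a b *m lax_prod l c d x = lax_prod l c d x *m site_unit k a b.
Proof.
elim: l c d => [|m l IHl] c d /=; first by rewrite mul_mx_scalar mul_scalar_mx.
rewrite inE negb_or => /andP[km kl].
rewrite /fam_mul mulmx_sumr mulmx_suml; apply: eq_bigr => e _.
rewrite -mulmxA -IHl // !mulmxA; congr (_ *m _).
rewrite /lax mulmxDr mulmxDl mul_mx_scalar mul_scalar_mx; congr (_ + _).
by rewrite -scalemxAr -scalemxAl (site_unitC _ _ _ _ km).
Qed.

Lemma lax_prod_comm k l : k \notin l -> fam_comm (lax k) (lax_prod l).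
Proof.
move=> kl a b c d x y; rewrite /lax mulmxDr mulmxDl mul_mx_scalar mul_scalar_mx.
by congr (_ + _); rewrite -scalemxAr -scalemxAl site_unit_lax_prod.
Qed.

Lemma lax_prod_RTT l : uniq l -> RTT eta (lax_prod l).
Proof.
elim: l => [_|k l IHl /= /andP[kl ul]]; last first.
  by apply: RTT_fam_mul; [exact: lax_prod_comm|exact: lax_RTT|exact: IHl].
move=> a b c d x y /=; rewrite -!scalar_mxM; apply/matrixP => i j.
by rewrite !(mxZE, mxDE, mxNE, scalar_mxE); ring.
Qed.

Lemma lax_prod_qdet l x : uniq l -> has_qdet eta (lax_prod l) x
  (\prod_(k <- l) ((x - xi k + eta) * (x - eta - xi k))).
Proof.
elim: l => [_|k l IHl /= /andP[kl ul]]; last first.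
  rewrite big_cons; apply: has_qdet_fam_mul; first exact: lax_prod_comm.
    exact: lax_qdet.
  exact: IHl.
rewrite big_nil => a b c d /=; rewrite -!scalar_mxM; apply/matrixP => i j.
rewrite !(mxZE, mxDE, mxNE, scalar_mxE) /eps2.
by case: a b c d => [] [] [] [] /=; ring.
Qed.

(** One fused site suffices: factors to its right preserve the row antisymmetry, and those to its
    left transmit it through their quantum determinants. *)
Lemma lax_prod_fused k l : uniq l -> k \in l -> fused eta (lax_prod l) (xi k).
Proof.
elim: l => [//|m l IHl /= /andP[ml ul]]; rewrite inE; case/orP => [/eqP ->|kl].
  by apply: fused_mull; [exact: lax_prod_comm|exact: lax_fused].
by apply: fused_mulr; [exact: lax_prod_comm|exact: lax_qdet|exact: IHl].
Qed.

Definition ref_cov : 'rV[K]_n := delta_mx 0 (enum_rank ([ffun=> false] : spins N)).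

Lemma ref_cov_neq0 : ref_cov != 0.
Proof.
apply/eqP => /rowP/(_ (enum_rank [ffun=> false])).
by rewrite !mxE !eqxx => /eqP; rewrite oner_eq0.
Qed.

Lemma ref_cov_up k b : ref_cov *m site_unit k true b = 0.
Proof. by rewrite -rowE; apply/rowP => j; rewrite !mxE enum_rankK ffunE. Qed.

Lemma ref_cov_down k : ref_cov *m site_unit k false false = ref_cov.
Proof.
rewrite -rowE; apply/rowP => j; rewrite !mxE enum_rankK ffunE eqxx /=.
rewrite (can2_eq enum_valK enum_rankK) (_ : set_spin _ _ _ = [ffun=> false]) //.
by apply/ffunP => m; rewrite !ffunE if_same.
Qed.

Lemma ref_cov_lax01 k x : ref_cov *m lax k false true x = 0.
Proof. by rewrite mulmxDr mul_mx_scalar mulr0 scale0r add0r -scalemxAr ref_cov_up scaler0. Qed.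

Lemma ref_cov_lax00 k x : ref_cov *m lax k false false x = (x - xi k + eta) *: ref_cov.
Proof. by rewrite mulmxDr mul_mx_scalar mulr1 -scalemxAr ref_cov_down -scalerDl. Qed.

Lemma ref_cov_lax11 k x : ref_cov *m lax k true true x = (x - xi k) *: ref_cov.
Proof. by rewrite mulmxDr mul_mx_scalar mulr1 -scalemxAr ref_cov_up scaler0 addr0. Qed.

(** On the all-up covector each Lax operator is lower triangular in the auxiliary space, and hence
    so is the product. *)
Lemma ref_cov_lax_prod01 l x : ref_cov *m lax_prod l false true x = 0.
Proof.
elim: l => [|k l IHl] /=; first by rewrite mul_mx_scalar scale0r.
rewrite /fam_mul mulmx_sumr big_bool /= !mulmxA ref_cov_lax01 mul0mx add0r.
by rewrite ref_cov_lax00 -scalemxAl IHl scaler0.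
Qed.

Lemma ref_cov_lax_prod11 l x : uniq l ->
  ref_cov *m lax_prod l true true x = (\prod_(k <- l) (x - xi k)) *: ref_cov.
Proof.
elim: l => [|k l IHl] /=; first by rewrite mul_mx_scalar big_nil.
case/andP=> kl ul; rewrite /fam_mul mulmx_sumr big_bool /= !mulmxA ref_cov_lax11.
(* The other term is C of site k times B of the remaining sites; commuting them brings B to the
   covector, which it annihilates. *)
rewrite -scalemxAl IHl // scalerA big_cons -mulmxA lax_prod_comm // mulmxA.
by rewrite ref_cov_lax_prod01 mul0mx addr0.
Qed.

Lemma polyfun_lax k a b i j : polyfun (a == b).+1 (fun x => lax k a b x i j).
Proof.
apply: (@eq_polyfun _ _ (fun x => (x - xi k) * ((a == b)%:R * (i == j)%:R)
                                  + eta * site_unit k b a i j)).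
  by move=> x; rewrite mxDE mxZE scalar_mxE mulrA.
apply: polyfunD; last first.
  by apply: polyfun_le (polyfun_cst _).
case: eqP => _ /=; last by apply: eq_polyfun (polyfun0 _ _) => x; ring.
apply: eq_polyfun (polyfunZ (1 * (i == j)%:R) (polyfun_sub (xi k))) => x; ring.
Qed.

(** An off-diagonal entry needs at least one off-diagonal factor, which is constant in x. Hence T
    has degree below N. *)
Lemma polyfun_lax_prod l a b i j :
  polyfun (size l + (a == b)) (fun x => lax_prod l a b x i j).
Proof.
elim: l a b i j => [|k l IHl] a b i j /=.
  case: eqP => _ /=; first exact: polyfun_cst.
  by apply: eq_polyfun (polyfun0 _ _) => x; rewrite scalar_mxE mul0r.
apply: (@eq_polyfun _ _ (fun x => \sum_(c : bool) \sum_m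
  lax k a c x i m * lax_prod l c b x m j)).
  by move=> x; rewrite /fam_mul summxE; apply: eq_bigr => c _; rewrite mxE.
apply: polyfun_sum => c; apply: polyfun_sum => m.
apply: polyfun_le (polyfunM (polyfun_lax k a c i m) (IHl c b m j)).
by case: a b c => [] [] []; rewrite /= ?addn0; lia.
Qed.

Local Notation mono := (lax_prod (rev (enum 'I_N))).

Lemma sites_uniq : uniq (rev (enum 'I_N)).
Proof. by rewrite rev_uniq enum_uniq. Qed.

Lemma prod_sites (F : 'I_N -> K) : \prod_(k <- rev (enum 'I_N)) F k = \prod_(k < N) F k.
Proof. by rewrite (perm_big (enum 'I_N)) ?perm_rev 1?perm_sym ?perm_rev //= big_enum. Qed.

Lemma is_eigenvalueP tau : is_eigenvalue eta xi tau <->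
  exists2 v : 'cV[K]_n, v != 0 & forall x, fam_twist mono x *m v = tau x *: v.
Proof.
have E (v : 'cV[K]_n) x i : (fam_twist mono x *m v) i 0
  = \sum_s' antiper_transfer eta xi x (enum_val i) s' * v (enum_rank s') 0.
  rewrite mxE [RHS]big_enum_val /=; apply: eq_bigr => j _; rewrite enum_valK.
  by congr (_ * _); rewrite /fam_twist -!kernel_mx_monodromy !mxE.
split=> [[v [[s vs] hv]]|[v v0 hv]].
  exists (\col_i v (enum_val i)).
    apply: contraNneq vs => /colP/(_ (enum_rank s)); rewrite !mxE enum_rankK.
    by move=> ->.
  move=> x; apply/colP => i; rewrite E !mxE -hv; apply: eq_bigr => s' _.
  by rewrite mxE enum_rankK.
exists (fun s => v (enum_rank s) 0); split.
  have [|i vi] := rV0Pn v^T _; first by rewrite trmx_eq0.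
  by exists (enum_val i); rewrite enum_valK; rewrite mxE in vi.
move=> x s; have := E v x (enum_rank s); rewrite enum_rankK => <-.
by rewrite hv mxE.
Qed.

(** Minus the quantum determinant of the monodromy matrix at xi k. *)
Definition fusion_val k := - (dfun xi (xi k + eta) * dfun xi (xi k - eta)).

Lemma transfer_fusion k :
  fam_twist mono (xi k) *m fam_twist mono (xi k - eta) = (fusion_val k)%:M.
Proof.
rewrite (twist_fusion (lax_prod_fused sites_uniq _) (lax_prod_qdet _ sites_uniq)).
  congr ((- _)%:M); rewrite prod_sites /dfun -big_split /=.
  by apply: eq_bigr => i _; congr (_ * _); rewrite addrAC.
by rewrite mem_rev mem_enum.
Qed.

Lemma polyfun_transfer i j : polyfun N (fun x => fam_twist mono x i j).
Proof.
have p a : polyfun N (fun x => mono a (~~ a) x i j).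
  have := polyfun_lax_prod (rev (enum 'I_N)) a (~~ a) i j.
  by rewrite size_rev size_enum_ord; case: a; rewrite /= addn0.
by apply: eq_polyfun (polyfunD (p false) (p true)) => x; rewrite mxDE.
Qed.

Hypothesis eta0 : eta != 0.
Hypothesis xi_generic : forall a b : 'I_N, a != b ->
  [/\ xi a != xi b, xi a != xi b + eta & xi a != xi b - eta].

Lemma dfun_shift_neq0 k : dfun xi (xi k + eta) != 0 /\ dfun xi (xi k - eta) != 0.
Proof.
split; apply/prodf_neq0 => i _; have [->|/xi_generic[h1 h2 h3]] := eqVneq k i.
- by rewrite addrAC subrr add0r.
- by rewrite subr_eq0 eq_sym -subr_eq eq_sym.
- by rewrite addrAC subrr add0r oppr_eq0.
- by rewrite subr_eq0 subr_eq.
Qed.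

Lemma eigenvalue_fusion tau : is_eigenvalue eta xi tau <->
  polyfun N tau /\ forall k, tau (xi k) * tau (xi k - eta) = fusion_val k.
Proof.
rewrite is_eigenvalueP; split=> [[v v0 hv]|[ptau htau]].
  have [|i vi] := rV0Pn v^T _; first by rewrite trmx_eq0.
  rewrite mxE in vi; split.
    (* A nonzero coordinate of [v] expresses [tau] linearly through the entries of T. *)
    apply: (@eq_polyfun _ _ (fun x => (v i 0)^-1 *
        \sum_j v j 0 * fam_twist mono x i j)).
      move=> x; apply: (mulfI vi); rewrite mulVKf //.
      have /colP/(_ i) := hv x; rewrite !mxE [RHS]mulrC => <-.
      by apply: eq_bigr => j _; rewrite mulrC.
    by apply: polyfunZ; apply: polyfun_sum => j; apply: polyfunZ; apply: polyfun_transfer.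
  move=> k; have := congr1 (mulmx^~ v) (transfer_fusion k).
  rewrite -mulmxA hv -scalemxAr hv scalerA mul_scalar_mx => /colP/(_ i).
  by rewrite !mxE => /(mulIf vi) <-; rewrite mulrC.
apply: (@twist_eigenvector _ _ _ _ _ ref_cov fusion_val eta0 xi_generic) => //.
- exact/lax_prod_RTT/sites_uniq.
- exact: transfer_fusion.
- by move=> k; rewrite oppr_eq0 mulf_neq0 //; case: (dfun_shift_neq0 k).
- exact: ref_cov_neq0.
- exact: ref_cov_lax_prod01.
- by move=> x; rewrite ref_cov_lax_prod11 ?sites_uniq // prod_sites.
- move=> a b i j; apply: polyfun_le (polyfun_lax_prod _ a b i j).
  by rewrite size_rev size_enum_ord; case: eqP; lia.
- exact: polyfun_transfer.
Qed.

End SpinChain.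

(** * Shifts of polynomials and periodic polynomials *)

Section PolynomialShift.
Variable K : numFieldType.
Implicit Types (p q : {poly K}) (c z : K).

Definition shiftp c p : {poly K} := p \Po ('X + c%:P).

Lemma horner_shiftp c p x : (shiftp c p).[x] = p.[x + c].
Proof. by rewrite horner_comp hornerD hornerX hornerC. Qed.

Lemma size_shiftp c p : size (shiftp c p) = size p.
Proof. by rewrite size_comp_poly2 // size_XaddC. Qed.

Lemma lead_coef_shiftp c p : lead_coef (shiftp c p) = lead_coef p.
Proof. by rewrite lead_coef_comp ?size_XaddC // lead_coefXaddC expr1n mulr1. Qed.

(** Shifts preserve the leading coefficient, so the top terms cancel; the degree bounds and zero
    counts below depend on this gain of one. *)
Lemma size_shiftpB c c' p : p != 0 ->
  (size (shiftp c p - shiftp c' p)%R <= (size p).-1)%N.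
Proof.
rewrite -size_poly_gt0 => p0; apply/leq_sizeP => j; rewrite leq_eqVlt coefB.
case/orP => [/eqP <-|pj].
  rewrite -{1}(size_shiftp c p) -(size_shiftp c' p) -!lead_coefE.
  by rewrite !lead_coef_shiftp subrr.
by rewrite !nth_default ?size_shiftp ?subrr //; move: pj; rewrite prednK.
Qed.

Lemma poly_multiples_roots0 z p : z != 0 ->
  (forall i : nat, p.[i%:R * z] = 0) -> p = 0.
Proof.
move=> z0 h; apply/eqP; apply: contraT => p0.
have := @max_poly_roots _ p [seq i%:R * z | i <- iota 0 (size p)] p0.
rewrite size_map size_iota ltnn => ->//.
  by apply/allP => _ /mapP[i _ ->]; rewrite /root h.
rewrite map_inj_uniq ?iota_uniq // => i j /(mulIf z0)/eqP.
by rewrite eqr_nat => /eqP.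
Qed.

Lemma horner_inj p q : (forall x, p.[x] = q.[x]) -> p = q.
Proof.
move=> pq; apply/eqP; rewrite -subr_eq0; apply/eqP.
by apply: (poly_multiples_roots0 (oner_neq0 K)) => i; rewrite hornerD hornerN pq subrr.
Qed.

Lemma periodic_poly_const z p : z != 0 -> (forall x, p.[x + z] = p.[x]) ->
  p = (p.[0])%:P.
Proof.
move=> z0 hp; apply/eqP; rewrite -subr_eq0; apply/eqP.
apply: (poly_multiples_roots0 z0) => i; rewrite hornerD hornerN hornerC.
apply/eqP; rewrite subr_eq0; apply/eqP.
by elim: i => [|i IHi]; rewrite ?mul0r // -addn1 natrD mulrDl mul1r hp.
Qed.

End PolynomialShift.

(** * The Baxter equation: polynomial solutions and their Wronskian relation *)

Section BaxterEquation.
Variables (K : numFieldType) (N : nat) (eta : K) (xi : 'I_N -> K).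
Local Notation d := (dfun xi).

Definition dpoly : {poly K} := \prod_(k < N) ('X - (xi k)%:P).

Lemma horner_dpoly x : dpoly.[x] = d x.
Proof. by rewrite horner_prod; apply: eq_bigr => k _; rewrite hornerXsubC. Qed.

Lemma size_dpoly : size dpoly = N.+1.
Proof. by rewrite size_prod_XsubC /index_enum unlock -enumT size_enum_ord. Qed.

Lemma lead_coef_dpoly : lead_coef dpoly = 1.
Proof. exact/monicP/monic_prod_XsubC. Qed.

Lemma dfun_xi k : d (xi k) = 0.
Proof. by rewrite /dfun (bigD1 k) //= subrr mul0r. Qed.

Definition baxter (t Q : {poly K}) := forall x,
  t.[x] * Q.[x] = d x * Q.[x + eta] - d (x + eta) * Q.[x - eta].

(** Inserting the Wronskian relation at x and x + eta into the Baxter equation leaves [q] as a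
    common factor, which cancels among polynomials. *)
Lemma baxter_solve (t p q : {poly K}) : q != 0 -> baxter t q ->
  (forall x, 2^-1 * (p.[x] * q.[x - eta] + q.[x] * p.[x - eta]) = d x) ->
  forall x, t.[x] = 2^-1 * (p.[x - eta] * q.[x + eta] - q.[x - eta] * p.[x + eta]).
Proof.
move=> q0 hq hW.
pose u := 2^-1%:P * (shiftp (- eta) p * shiftp eta q - shiftp (- eta) q * shiftp eta p).
have uE x : u.[x] = 2^-1 * (p.[x - eta] * q.[x + eta] - q.[x - eta] * p.[x + eta]).
  by rewrite !(hornerM, hornerD, hornerN, hornerC, horner_shiftp).
suff : t * q = u * q by move=> /(mulIf q0) tu x; rewrite -uE -tu.
apply: horner_inj => x; rewrite (hornerM t) (hornerM u) uE hq -!hW addrK.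
by ring.
Qed.

Lemma polyfun_wronskian (p q : {poly K}) c r : (r <= N)%N ->
  size q = r.+1 -> size p = (N - r).+1 ->
  polyfun N (fun x => c * (p.[x - eta] * q.[x + eta] - q.[x - eta] * p.[x + eta])).
Proof.
move=> rN sq sp.
(* Each difference of shifts loses one degree, lowering the size bound from N + 1 to N. *)
exists (c%:P * (shiftp (- eta) p * (shiftp eta q - shiftp (- eta) q)
   + shiftp (- eta) q * (shiftp (- eta) p - shiftp eta p))); last first.
  by move=> x; rewrite !(hornerM, hornerD, hornerN, hornerC, horner_shiftp); ring.
have p0 : p != 0 by rewrite -size_poly_gt0 sp.
have q0 : q != 0 by rewrite -size_poly_gt0 sq.
have s1 := size_shiftpB eta (- eta) q0; rewrite sq /= in s1.
have s2 := size_shiftpB (- eta) eta p0; rewrite sp /= in s2.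
have m1 := size_polyMleq (shiftp (- eta) p) (shiftp eta q - shiftp (- eta) q).
have m2 := size_polyMleq (shiftp (- eta) q) (shiftp (- eta) p - shiftp eta p).
rewrite size_shiftp sp in m1; rewrite size_shiftp sq in m2.
rewrite mul_polyC (leq_trans (size_scale_leq _ _)) //.
rewrite (leq_trans (size_polyD _ _)) // geq_max; apply/andP; split.
  by apply: leq_trans m1 _; move: s1; case: (size _) => [|s]; lia.
by apply: leq_trans m2 _; move: s2; case: (size _) => [|s]; lia.
Qed.

Lemma wronskian_fusion (p q : {poly K}) (e : K) : e * e = 1 ->
  (forall x, 2^-1 * (p.[x] * q.[x - eta] + q.[x] * p.[x - eta]) = d x) ->
  let tau x := e * 2^-1 * (p.[x - eta] * q.[x + eta] - q.[x - eta] * p.[x + eta]) in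
  forall k, tau (xi k) * tau (xi k - eta) = fusion_val eta xi k.
Proof.
move=> ee hW tau k; rewrite /tau /fusion_val -!hW addrK subrK.
have h0 := hW (xi k); rewrite dfun_xi in h0.
set h := 2^-1 * _ in h0.
(* A Pluecker-type identity: the product is a multiple of [h], which is d(xi k) = 0, minus d(xi k +
   eta) d(xi k - eta). *)
transitivity (e * e * (h * (2^-1 * (q.[xi k + eta] * p.[xi k - eta - eta]
                                    + p.[xi k + eta] * q.[xi k - eta - eta]))
   - 2^-1 * (p.[xi k + eta] * q.[xi k] + q.[xi k + eta] * p.[xi k])
     * (2^-1 * (p.[xi k - eta] * q.[xi k - eta - eta]
                + q.[xi k - eta] * p.[xi k - eta - eta])))).
  by rewrite /h; ring.
by rewrite ee h0 mul1r mul0r sub0r.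
Qed.

Hypothesis eta0 : eta != 0.
Hypothesis xi_generic : forall a b : 'I_N, a != b ->
  [/\ xi a != xi b, xi a != xi b + eta & xi a != xi b - eta].

Lemma xi_inj : injective xi.
Proof.
move=> i j e; apply/eqP; apply: contraT => /xi_generic[].
by rewrite e eqxx.
Qed.

Lemma sites_shift_uniq :
  uniq ([seq xi k | k <- enum 'I_N] ++ [seq xi k - eta | k <- enum 'I_N]).
Proof.
have inj' : injective (fun k => xi k - eta) by move=> i j /addIr/xi_inj.
rewrite cat_uniq (map_inj_uniq xi_inj) (map_inj_uniq inj') enum_uniq /=.
rewrite andbT; apply/hasPn => _ /mapP[k _ ->]; apply/mapP => -[m _ /eqP].
by rewrite eq_sym (negbTE (xi_shift_neq eta0 xi_generic _ _)).
Qed.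

(* These are N homogeneous linear conditions on the N + 1 coefficients of Q. *)
Lemma baxter_at_sites (t : {poly K}) : exists2 Q : {poly K},
  Q != 0 /\ (size Q <= N.+1)%N &
  forall k, d (xi k + eta) * Q.[xi k - eta] = - (t.[xi k] * Q.[xi k]).
Proof.
pose M : 'M[K]_(N.+1, N) := \matrix_(i, k)
  (d (xi k + eta) * (xi k - eta) ^+ i + t.[xi k] * xi k ^+ i).
have : kermx M != 0.
  rewrite kermx_eq0 /row_free neq_ltn ltnS.
  by rewrite (leq_trans (rank_leq_col M)).
case/rowV0Pn => u /sub_kermxP uM u0; exists (rVpoly u); first split.
- by rewrite -(inj_eq (can_inj rVpolyK)) raddf0 in u0 *.
- exact: size_poly.
move=> k; apply/eqP; rewrite -subr_eq0 opprK; apply/eqP.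
have /rowP/(_ k) := uM; rewrite !mxE => <-.
have hor x : (rVpoly u).[x] = \sum_(i < N.+1) u 0 i * x ^+ i.
  rewrite (horner_coef_wide _ (size_poly _ _)); apply: eq_bigr => i _.
  by rewrite coef_rVpoly_ord.
rewrite !hor !mulr_sumr -big_split; apply: eq_bigr => i _ /=.
by rewrite mxE; ring.
Qed.

Lemma baxter_exists (t : {poly K}) : (size t <= N)%N ->
  (forall k, t.[xi k] * t.[xi k - eta] = fusion_val eta xi k) ->
  exists2 Q : {poly K}, Q != 0 & baxter t Q.
Proof.
move=> st ht; have [Q [Q0 sQ] hQ] := baxter_at_sites t; exists Q => //.
(* The grouping into differences of shifts keeps the size of [F] within 2N, the number of its known
   zeros; [shiftp 0 dpoly] stands for [dpoly] so that [size_shiftpB] applies. *)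
pose F := t * Q - (dpoly * (shiftp eta Q - shiftp (- eta) Q)
   + (shiftp 0 dpoly - shiftp eta dpoly) * shiftp (- eta) Q).
have FE x : F.[x] = t.[x] * Q.[x] - (d x * Q.[x + eta] - d (x + eta) * Q.[x - eta]).
  rewrite !(hornerD, hornerN, hornerM, horner_shiftp) !horner_dpoly addr0.
  by ring.
have sF : (size F <= N + N)%N.
  have d0 : dpoly != 0 by rewrite -size_poly_gt0 size_dpoly.
  have sQ0 : (0 < size Q)%N by rewrite size_poly_gt0.
  have s1 := size_shiftpB eta (- eta) Q0.
  have s2 := size_shiftpB 0 eta d0; rewrite size_dpoly /= in s2.
  have m1 := size_polyMleq t Q.
  have m2 := size_polyMleq dpoly (shiftp eta Q - shiftp (- eta) Q).
  have m3 := size_polyMleq (shiftp 0 dpoly - shiftp eta dpoly) (shiftp (- eta) Q).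
  rewrite size_dpoly in m2; rewrite size_shiftp in m3.
  rewrite (leq_trans (size_polyD _ _)) // size_polyN geq_max.
  apply/andP; split; first by lia.
  rewrite (leq_trans (size_polyD _ _)) // geq_max; apply/andP; split.
    apply: leq_trans m2 _; move: s1; case: (size _) => [|s]; lia.
  apply: leq_trans m3 _; move: s2. case: (size _) => [|s]; lia.
have F0 : F = 0.
  apply/eqP; apply: contraTT sF => F0; rewrite -ltnNge.
  have := max_poly_roots F0 _ sites_shift_uniq.
  rewrite size_cat !size_map -enumT size_enum_ord => -> //.
  rewrite all_cat; apply/andP; split; apply/allP => _ /mapP[k _ ->].
    by rewrite /root FE dfun_xi hQ; apply/eqP; ring.
  rewrite /root FE subrK dfun_xi; apply/eqP.
  have [dk _] := dfun_shift_neq0 eta0 xi_generic k.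
  apply: (mulfI dk); rewrite mulr0.
  transitivity (t.[xi k - eta] * (d (xi k + eta) * Q.[xi k - eta])
     - d (xi k + eta) * d (xi k - eta) * Q.[xi k]); first by ring.
  rewrite hQ -[d _ * d _]opprK -/(fusion_val eta xi k) -ht.
  by ring.
move=> x; apply/eqP; rewrite -subr_eq0 -FE F0 horner0 //.
Qed.

Lemma baxter_wronskian (t P Q : {poly K}) : P != 0 -> Q != 0 ->
  baxter t Q -> baxter (- t) P ->
  (size P + size Q = N.+2)%N /\
  forall x, P.[x] * Q.[x - eta] + Q.[x] * P.[x - eta]
            = 2 * lead_coef P * lead_coef Q * d x.
Proof.
move=> P0 Q0 hQ hP.
pose W1 := P * shiftp (- eta) Q; pose W2 := Q * shiftp (- eta) P.
pose W := W1 + W2.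
have WE x : W.[x] = P.[x] * Q.[x - eta] + Q.[x] * P.[x - eta].
  by rewrite hornerD !hornerM !horner_shiftp.
have sh0 (p : {poly K}) c : p != 0 -> shiftp c p != 0.
  by move=> p0; rewrite -size_poly_gt0 size_shiftp size_poly_gt0.
have sW1 : size W1 = (size P + size Q).-1.
  by rewrite size_mul ?sh0 // size_shiftp.
have sW2 : size W2 = (size P + size Q).-1.
  by rewrite size_mul ?sh0 // size_shiftp addnC.
have PQ0 : lead_coef P * lead_coef Q != 0 by rewrite mulf_neq0 ?lead_coef_eq0.
(* [W1] and [W2] have equal leading coefficients, so their sum keeps full degree in characteristic
   0. *)
have cW : W`_(size P + size Q).-2 = 2 * lead_coef P * lead_coef Q.
  rewrite coefD -{1}sW1 -sW2 -!lead_coefE !lead_coefM !lead_coef_shiftp.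
  by ring.
have sPQ : (1 < size P + size Q)%N.
  by have := P0; have := Q0; rewrite -!size_poly_gt0; lia.
have sW : size W = (size P + size Q).-1.
  apply/eqP; rewrite eqn_leq; apply/andP; split.
    by rewrite (leq_trans (size_polyD _ _)) // sW1 sW2 maxnn.
  have : W`_(size P + size Q).-2 != 0 by rewrite cW -mulrA mulf_neq0 ?pnatr_eq0.
  rewrite leqNgt; apply: contraNN => h; rewrite nth_default //.
  by move: h; case: (size P + size Q)%N sPQ => [|[|m]].
(* Multiplying the equation of [Q] by [P] and that of [P] by [Q], then adding, eliminates [t], since
   it occurs with opposite signs. *)
have hW x : d x * W.[x + eta] = d (x + eta) * W.[x].
  rewrite !WE addrK; have := hQ x; have := hP x; rewrite hornerN => h1 h2.
  apply/eqP; rewrite -subr_eq0; apply/eqP.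
  transitivity ((d x * Q.[x + eta] - d (x + eta) * Q.[x - eta]) * P.[x]
     + (d x * P.[x + eta] - d (x + eta) * P.[x - eta]) * Q.[x]); first by ring.
  by rewrite -h1 -h2; ring.
have /dvdpP [g Wg] : dpoly %| W.
  rewrite /dpoly -(big_map xi xpredT (fun z => 'X - z%:P)); apply: uniq_roots_dvdp.
    apply/allP => _ /mapP[k _ ->]; rewrite /root.
    have := hW (xi k); rewrite dfun_xi mul0r => /esym/eqP; rewrite mulf_eq0.
    by have [/negbTE-> _] := dfun_shift_neq0 eta0 xi_generic k.
  by rewrite uniq_rootsE map_inj_uniq ?index_enum_uniq //; exact: xi_inj.
have d0 : dpoly != 0 by rewrite -size_poly_gt0 size_dpoly.
(* Dividing W by d turns the functional equation into periodicity, which forces [g] to be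
   constant. *)
have gper x : g.[x + eta] = g.[x].
  have : (dpoly * shiftp eta dpoly) * (shiftp eta g - g) = 0.
    apply: horner_inj => y; have := hW y; rewrite Wg !hornerM !horner_dpoly horner0.
    rewrite hornerD hornerN !horner_shiftp horner_dpoly => h.
    apply/eqP; rewrite mulrBr subr_eq0; apply/eqP.
    transitivity (d y * (g.[y + eta] * d (y + eta))); first by ring.
    by rewrite h; ring.
  move/eqP; rewrite mulf_eq0 mulf_eq0 (negbTE d0) (negbTE (sh0 _ _ d0)) /= subr_eq0.
  by move/eqP/(congr1 (horner^~ x)); rewrite horner_shiftp.
have gC := periodic_poly_const eta0 gper.
have g0 : g.[0] != 0.
  apply: contraTneq sPQ => g0; rewrite gC g0 mul0r in Wg.
  by have := cW; rewrite Wg coef0 -mulrA => /esym/eqP; rewrite !mulf_eq0 pnatr_eq0 -mulf_eq0 (negbTE PQ0).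
have sWN : size W = N.+1 by rewrite Wg gC mul_polyC size_scale ?size_dpoly.
split; first by move: sW; rewrite sWN; lia.
move=> x; rewrite -WE Wg hornerM horner_dpoly; congr (_ * _).
rewrite gC hornerC -cW.
have -> : (size P + size Q).-2 = N by move: sW; rewrite sWN; lia.
have := lead_coef_dpoly; rewrite lead_coefE size_dpoly /= => dN.
by rewrite Wg {2}gC mul_polyC coefZ dN mulr1.
Qed.

End BaxterEquation.

(** * From the fusion relations to pairs of polynomials, and back *)

Theorem theorem4 (R : realType) (N : nat) (eta : R[i]) (xi : 'I_N -> R[i]) :
  (0 < N)%N -> eta != 0 ->
  (forall a b : 'I_N, a != b ->
     [/\ xi a != xi b, xi a != xi b + eta & xi a != xi b - eta]) ->
  forall tau : R[i] -> R[i],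
    is_eigenvalue eta xi tau <->
    exists (eps : R[i]) (r : nat) (p q : {poly R[i]}),
      (eps = 1 \/ eps = -1) /\
      (r <= N./2)%N /\
      size q = r.+1 /\
      size p = (N - r).+1 /\
          (forall lam, tau lam =
             eps * 2^-1 * (p.[lam - eta] * q.[lam + eta] - q.[lam - eta] * p.[lam + eta])) /\
      (forall lam, 2^-1 * (p.[lam] * q.[lam - eta] + q.[lam] * p.[lam - eta])
                       = dfun xi lam).
Proof.
move=> _ eta0 xi_generic tau; split.
  case/(eigenvalue_fusion eta0 xi_generic tau) => -[t st ht] hf.
  have {}hf k : t.[xi k] * t.[xi k - eta] = fusion_val eta xi k by rewrite -!ht.
  have [Q Q0 hQ] := baxter_exists eta0 xi_generic st hf.
  have [|k|P P0 hP] := @baxter_exists _ _ _ _ eta0 xi_generic (- t).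
  - by rewrite size_polyN.
  - by rewrite !hornerN mulrNN hf.
  have [sPQ W] := baxter_wronskian eta0 xi_generic P0 Q0 hQ hP.
  (* Scaling [P] by [c] reduces the constant of the Wronskian relation to 2. *)
  pose c := (lead_coef P * lead_coef Q)^-1.
  have c0 : c != 0 by rewrite invr_eq0 mulf_neq0 ?lead_coef_eq0.
  have cK : c * (lead_coef P * lead_coef Q) = 1.
    by rewrite mulVf // mulf_neq0 ?lead_coef_eq0.
  have n2 : (2 : R[i]%C) != 0 by rewrite pnatr_eq0.
  have WP x : 2^-1 * ((c *: P).[x] * Q.[x - eta] + Q.[x] * (c *: P).[x - eta]) = dfun xi x.
    rewrite !hornerZ.
    transitivity (2^-1 * (c * (P.[x] * Q.[x - eta] + Q.[x] * P.[x - eta]))); first by ring.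
    rewrite W.
    transitivity (2^-1 * 2 * (c * (lead_coef P * lead_coef Q)) * dfun xi x); first by ring.
    by rewrite cK mulVf // !mul1r.
  have WQ x : 2^-1 * (Q.[x] * (c *: P).[x - eta] + (c *: P).[x] * Q.[x - eta]) = dfun xi x.
    by rewrite -WP addrC.
  have scP : size (c *: P) = size P by rewrite size_scale.
  have sP0 : (0 < size P)%N by rewrite size_poly_gt0.
  have sQ0 : (0 < size Q)%N by rewrite size_poly_gt0.
  (* The degrees of [P] and [Q] add up to N, so one is at most N/2. If it is that of [P], the roles
     are exchanged and the sign is -1, because [P] solves the equation for [- t]. *)
  have [sQ|sQ] := leqP (size Q).-1 N./2.
    exists 1, (size Q).-1, (c *: P), Q; split; first by left.
    split=> //; split; first by rewrite prednK.
    split; first by rewrite scP; lia.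
    by split=> // x; rewrite mul1r ht (baxter_solve Q0 hQ WP).
  exists (-1), (size P).-1, Q, (c *: P); split; first by right.
  split; first by lia.
  split; first by rewrite scP prednK.
  split; first by move: sPQ sP0 sQ0; move: (size _) (size _) => m1 m2; lia.
  split=> // x; rewrite ht -[t]opprK hornerN mulN1r mulNr; congr (- _).
  apply: (@baxter_solve _ _ _ xi) WQ x; first by rewrite scaler_eq0 (negbTE c0).
  by move=> x; rewrite !hornerZ mulrCA hP; ring.
case=> e [r [p [q [he [rN [sq [sp [htau hW]]]]]]]].
apply/(eigenvalue_fusion eta0 xi_generic tau).
have ee : e * e = 1 by case: he => ->; rewrite ?mulrNN mulr1.
split; first last.
  by move=> k; rewrite !htau (wronskian_fusion ee hW).
have rN' : (r <= N)%N by lia.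
by apply: eq_polyfun (polyfun_wronskian eta (e * 2^-1) rN' sq sp) => x; rewrite htau.
Qed.
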